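(* Every regular lightlike surface $\Sigma$ of constant type in $\mathbb{R}^{2,1}$ is ruled by null lines; that is, every point of $\Sigma$ has an open neighborhood in $\Sigma$ that is smoothly foliated by open segments of straight lines in $\mathbb{R}^{2,1}$ whose direction vectors are null.
   Context: All objects are smooth ($C^\infty$). $\mathbb{R}^{2,1}$ denotes $\mathbb{R}^3$ with coordinates $(x^0,x^1,x^2)$ and with the indefinite inner product $\langle \mathbf{v},\mathbf{w}\rangle = -v^0w^0+v^1w^1+v^2w^2$ on each tangent space. A nonzero vector $\mathbf{v}$ is null (lightlike) if $\langle \mathbf{v},\mathbf{v}\rangle=0$. A regular surface $\Sigma \subset \mathbb{R}^{2,1}$ is lightlike if the restriction of $\langle\cdot,\cdot\rangle$ to each tangent plane $T_{\mathbf{x}}\Sigma$ is degenerate. Adapted frames. Let $\Sigma$ be a lightlike surface. A 0-adapted frame on (an open subset of) $\Sigma$ is a smooth choice of basis $(\mathbf{e}_0,\mathbf{e}_1,\mathbf{e}_2)$ of $\mathbb{R}^{2,1}$ at each point $\mathbf{x}$ such that $\mathbf{e}_0,\mathbf{e}_1$ span $T_{\mathbf{x}}\Sigma$, $\langle \mathbf{e}_0,\mathbf{e}_0\rangle=\langle \mathbf{e}_0,\mathbf{e}_1\rangle=\langle \mathbf{e}_1,\mathbf{e}_2\rangle=\langle \mathbf{e}_2,\mathbf{e}_2\rangle=0$ and $\langle \mathbf{e}_0,\mathbf{e}_2\rangle=\langle \mathbf{e}_1,\mathbf{e}_1\rangle=1$. Its Maurer-Cartan forms are the 1-forms $\omega^\alpha,\omega^\alpha_\beta$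 ($0\le\alpha,\beta\le 2$) on $\Sigma$ defined by $d\mathbf{x}=\sum_\alpha \mathbf{e}_\alpha\omega^\alpha$ and $d\mathbf{e}_\beta=\sum_\alpha \mathbf{e}_\alpha\omega^\alpha_\beta$. One has $\omega^2=0$, and $\omega^0,\omega^1$ form a coframe on $\Sigma$. For every 0-adapted frame there is a function $a_1$ with $\omega^1_0=a_1\omega^1$; whether $a_1$ vanishes at a point does not depend on the 0-adapted frame chosen. If $a_1$ is nowhere zero, a 0-adapted frame with $a_1\equiv 1$ is called 1-adapted (such frames exist locally). For every 1-adapted frame there is a function $a_2$ with $\omega^0_0-\omega^0=a_2\omega^1$; whether $a_2$ vanishes at a point does not depend on the 1-adapted frame chosen. $\Sigma$ is of constant type if either $a_1$ is identically zero on $\Sigma$, or $a_1$ is nowhere zero on $\Sigma$ and $a_2$ is either identically zero or nowhere zero on $\Sigma$. *)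

(* Defs.v *)
From HB Require Import structures.
From mathcomp Require Import all_boot all_order all_algebra.
From mathcomp Require Import all_classical all_reals all_analysis.

Set Implicit Arguments.
Unset Strict Implicit.
Unset Printing Implicit Defensive.

Import Order.TTheory GRing.Theory Num.Theory.
Import numFieldNormedType.Exports.

Local Open Scope classical_set_scope.
Local Open Scope ring_scope.

Section Smooth.
Context {R : realType} {V W : normedModType R}.

(* The usual C^k condition when V is finite-dimensional, which is the only
   case used below. *)
Fixpoint Ck (k : nat) (U : set V) (f : V -> W) : Prop :=
  if k is k'.+1 then
    (forall x, U x -> differentiable f x) /\
    (forall v, Ck k' U (fun x => 'D_v f x))
  else forall x, U x -> {for x, continuous f}.

Definition smooth_on (U : set V) (f : V -> W) : Prop := forall k, Ck k U f.

End Smooth.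

Section Surfaces.
Context {R : realType}.
Implicit Types (S W : set 'rV[R]_3) (p q v w : 'rV[R]_3).

Definition mink v w : R :=
  - (v 0 0 * w 0 0) + v 0 1 * w 0 1 + v 0 2 * w 0 2.

Definition null_vector v : Prop := v != 0 /\ mink v v = 0.

Definition open_in S W : Prop := exists2 O, open O & W = S `&` O.

(* X restricted to U is a smooth immersion and a homeomorphism onto an open
   subset of S. *)
Definition local_param S (U : set 'rV[R]_2) (X : 'rV[R]_2 -> 'rV[R]_3) : Prop :=
  [/\ open U,
      smooth_on U X,
      open_in S (X @` U),
      exists2 Y : 'rV[R]_3 -> 'rV[R]_2,
        (forall z, U z -> Y (X z) = z) & {within X @` U, continuous Y}
    & forall z, U z -> injective ('d X z)].

Definition regular_surface S : Prop :=
  forall p, S p -> exists U X, local_param S U X /\ (X @` U) p.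

Definition curve_through S p v (c : R -> 'rV[R]_3) : Prop :=
  exists2 eps : R, 0 < eps &
    [/\ smooth_on `]- eps, eps[%classic c,
        forall t, t \in `]- eps, eps[ -> S (c t),
        c 0 = p
      & is_derive (0 : R) 1 c v].

Definition tangent S p v : Prop := exists c, curve_through S p v c.

Definition lightlike S : Prop :=
  forall p, S p ->
    exists v, [/\ tangent S p v, v != 0
                & forall w, tangent S p w -> mink v w = 0].

Definition smooth_on_surface S W (f : 'rV[R]_3 -> 'rV[R]_3) : Prop :=
  forall p, W p ->
    exists U X, [/\ local_param S U X, (X @` U) p, X @` U `<=` W
                  & smooth_on U (f \o X)].

(* df_p(v) = w, where f is a function on a neighbourhood of p in S and v is
   tangent to S at p. *)
Definition surface_diff S (f : 'rV[R]_3 -> 'rV[R]_3) p v w : Prop :=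
  forall c, curve_through S p v c -> is_derive (0 : R) 1 (f \o c) w.

Definition adapted0 S W (e : 'I_3 -> 'rV[R]_3 -> 'rV[R]_3) : Prop :=
  [/\ open_in S W,
      forall i, smooth_on_surface S W (e i)
    & forall p, W p ->
      [/\ basis_of fullv [:: e 0 p; e 1 p; e 2 p],
          forall v, tangent S p v <->
            exists a b : R, v = a *: e 0 p + b *: e 1 p,
          [/\ mink (e 0 p) (e 0 p) = 0, mink (e 0 p) (e 1 p) = 0,
              mink (e 1 p) (e 2 p) = 0 & mink (e 2 p) (e 2 p) = 0],
          mink (e 0 p) (e 2 p) = 1
        & mink (e 1 p) (e 1 p) = 1]].

(* om i p v is omega^i at p applied to v, and omm i j p v is omega^i_j at p
   applied to v; only their values on v in T_p S are meaningful. *)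
Definition maurer_cartan S W (e : 'I_3 -> 'rV[R]_3 -> 'rV[R]_3)
    (om : 'I_3 -> 'rV[R]_3 -> 'rV[R]_3 -> R)
    (omm : 'I_3 -> 'I_3 -> 'rV[R]_3 -> 'rV[R]_3 -> R) : Prop :=
  forall p v, W p -> tangent S p v ->
    surface_diff S id p v (\sum_i om i p v *: e i p) /\
    forall j, surface_diff S (e j) p v (\sum_i omm i j p v *: e i p).

Definition is_a1 S W (om : 'I_3 -> 'rV[R]_3 -> 'rV[R]_3 -> R)
    (omm : 'I_3 -> 'I_3 -> 'rV[R]_3 -> 'rV[R]_3 -> R) (a1 : 'rV[R]_3 -> R) :=
  forall p v, W p -> tangent S p v -> omm 1 0 p v = a1 p * om 1 p v.

Definition is_a2 S W (om : 'I_3 -> 'rV[R]_3 -> 'rV[R]_3 -> R)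
    (omm : 'I_3 -> 'I_3 -> 'rV[R]_3 -> 'rV[R]_3 -> R) (a2 : 'rV[R]_3 -> R) :=
  forall p v, W p -> tangent S p v ->
    omm 0 0 p v - om 0 p v = a2 p * om 1 p v.

(* Vanishing at a point does not depend on the frame, so it is tested on some
   frame defined near the point. *)
Definition a1_vanishes_at S p : Prop :=
  exists W e om omm a1,
    [/\ W p, adapted0 S W e, maurer_cartan S W e om omm,
        is_a1 S W om omm a1 & a1 p = 0].

Definition a2_vanishes_at S p : Prop :=
  exists W e om omm a2,
    [/\ W p, adapted0 S W e, maurer_cartan S W e om omm,
        is_a1 S W om omm (fun=> 1)
      & is_a2 S W om omm a2 /\ a2 p = 0].

Definition constant_type S : Prop :=
  (forall p, S p -> a1_vanishes_at S p) \/
  ((forall p, S p -> ~ a1_vanishes_at S p) /\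
   ((forall p, S p -> a2_vanishes_at S p) \/
    (forall p, S p -> ~ a2_vanishes_at S p))).

Definition null_segment (L : set 'rV[R]_3) : Prop :=
  exists (x v : 'rV[R]_3) (a b : R),
    [/\ null_vector v, a < b & L = [set x + t *: v | t in `]a, b[%classic]].

Definition rectangle (a b c d : R) : set 'rV[R]_2 :=
  [set z : 'rV[R]_2 | a < z 0 0 < b /\ c < z 0 1 < d].

(* Phi is a chart of W, flat for the family F: each member of F meets the
   chart in a (possibly empty) countable union of slices z 0 0 = const. *)
Definition flat_chart S W (F : set (set 'rV[R]_3)) (a b c d : R)
    (Phi : 'rV[R]_2 -> 'rV[R]_3) : Prop :=
  [/\ local_param S (rectangle a b c d) Phi,
      Phi @` rectangle a b c d `<=` W
    & forall L, F L -> exists2 A : set R, countable A &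
        forall z, rectangle a b c d z -> (L (Phi z) <-> A (z 0 0))].

(* The leaves in F are connected one-dimensional submanifolds because they are
   segments, so the usual axioms of a foliation of the open set W reduce to:
   the leaves partition W, and flat charts exist around every point. *)
Definition foliated_by_null_segments S W (F : set (set 'rV[R]_3)) : Prop :=
  [/\ forall L, F L -> null_segment L,
      trivIset F id,
      \bigcup_(L in F) L = W
    & forall p, W p -> exists a b c d Phi,
        flat_chart S W F a b c d Phi /\ (Phi @` rectangle a b c d) p].

Definition ruled_by_null_lines S : Prop :=
  forall p, S p -> exists W F,
    [/\ open_in S W, W p & foliated_by_null_segments S W F].

End Surfaces.

(* Main.v *)
From HB Require Import structures.
Require Import Defs.
From mathcomp Require Import all_boot all_order all_algebra.
From mathcomp Require Import all_classical all_reals all_analysis.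
From mathcomp Require Import ring lra.

Set Implicit Arguments.
Unset Strict Implicit.
Unset Printing Implicit Defensive.

Import Order.TTheory GRing.Theory Num.Theory.
Import numFieldNormedType.Exports.

Local Open Scope classical_set_scope.
Local Open Scope ring_scope.

(** A lightlike surface is locally the graph [x0 = u (x1, x2)] of a solution of
    the eikonal equation [|grad u| = 1], and the characteristics of that
    equation are the null lines.

    In a chart [X], the Lorentzian cross product [K] of the two partial
    derivatives of [X] is orthogonal to the tangent plane.  Lightlikeness makes
    the Gram determinant of the tangent plane vanish, so [K] is null
    ([normal_null]).  A null vector has a nonzero time component, hence no
    tangent vector is vertical, and the projection [f] of [X] to the [(x1, x2)]
    plane has an injective differential.  It is therefore a local homeomorphism
    ([local_homeo]), and [u := X0 o f^-1] is differentiable with gradient the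
    unit vector [(K1, K2) / K0].

    Let [u] satisfy [|grad u| = 1] on a disc of centre [x] and radius [r].  It
    is 1-Lipschitz there.  For [e > 0] the maximum over the disc of
    [u y - (1 - e) |y - x|] is attained on the boundary, because at an interior
    point a step along [grad u] increases the function.  Letting [e] tend to 0,
    some [y] on the boundary satisfies [u y = u x + r], so [u] is affine of
    slope 1 on the segment from [x] to [y], whose direction can only be
    [grad u x] ([eikonal_line]).  Lifted to the graph, this says that
    [X z + t K z] lies on the surface for all small [t] ([null_lines]).  The
    argument uses first derivatives only; it replaces the symmetry of the
    Hessian and the uniqueness of integral curves by a compactness argument.

    Choose a vector [b] whose image under [dX] at [z0] is independent of
    [K z0].  Then [Phi (s, t) := X (z0 + s b) + t K (z0 + s b)] is smooth, takes
    its values in the surface, and its planar projection has an injective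
    differential at 0.  By [local_homeo] once more, [Phi] is a parametrization
    of an open piece of the surface ([ruling_param]), and the curves of constant
    [s] are the leaves. *)

(** * Smooth maps *)

Section Approx.
Context {R : realType} {V W : normedModType R}.

Lemma differentiable_approx (f : V -> W) (x : V) (e : R) :
  differentiable f x -> 0 < e ->
  \forall y \near x, `|f y - f x - 'd f x (y - x)| <= e * `|y - x|.
Proof.
move=> /diff_locally fx e0.
have /eqaddoP /(_ _ e0) := fx.
rewrite [X in _ -> X](near_shift 0) subr0 => H.
apply: filterS H => h /=.
by rewrite addrK opprD addrA.
Qed.

(** The converse, for a candidate differential [L].  It applies to functions that
    are only controlled through estimates, such as those defined by inverting
    another map. *)
Lemma approx_differentiable (f : V -> W) (x : V) (L : {linear V -> W}) :
  continuous L ->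
  (forall e : R, 0 < e ->
     \forall y \near x, `|f y - f x - L (y - x)| <= e * `|y - x|) ->
  differentiable f x /\ 'd f x = L :> (V -> W).
Proof.
move=> Lc fL.
have fx : f \o shift x = cst (f x) + L +o_ 0 id.
  apply/eqaddoP => e e0; move: (fL e e0).
  rewrite (near_shift 0) subr0 => H; apply: filterS H => h /=.
  by rewrite addrK opprD addrA.
have dfL := diff_unique Lc fx.
by split=> //; apply/diff_locallyP; rewrite dfL.
Qed.

End Approx.

Section CkTheory.
Context {R : realType} {V : normedModType R}.
Implicit Types (U : set V) (k : nat).

Lemma Ck_subset (W : normedModType R) k U U' (f : V -> W) :
  U' `<=` U -> Ck k U f -> Ck k U' f.
Proof.
move=> sU; elim: k f => [|k IH] f /=; first by move=> fc x /sU; exact: fc.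
by move=> [fd fD]; split=> [x /sU/fd//|v]; exact/IH/fD.
Qed.

Lemma CkS (W : normedModType R) k U (f : V -> W) : Ck k.+1 U f -> Ck k U f.
Proof.
elim: k f => [|k IH] f; first by move=> [fd _] x /fd/differentiable_continuous.
by move=> [fd fD]; split=> // v; exact/IH/fD.
Qed.

(** Sum and product rules for [derive] hold only on the open set where the
    factors are differentiable; this is what makes them usable inductively. *)
Lemma Ck_eq_on (W : normedModType R) k U (f g : V -> W) :
  open U -> (forall x, U x -> f x = g x) -> Ck k U f -> Ck k U g.
Proof.
move=> oU; elim: k f g => [|k IH] f g fg /=.
  move=> fc x Ux; suff : g @ x --> g x by [].
  rewrite -fg//; apply: cvg_trans (fc x Ux); apply: near_eq_cvg.
  by near=> y; apply: fg; near: y; exact: open_nbhs_nbhs.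
move=> [fd fD]; have fgn x : U x -> \forall y \near x, f y = g y.
  by move=> Ux; near=> y; apply: fg; near: y; exact: open_nbhs_nbhs.
split=> [x Ux|v].
  have fdx := fd _ Ux.
  have [] // := @approx_differentiable _ _ _ g x ('d f x).
    exact: diff_continuous.
  move=> e e0; near=> y; rewrite -(fg x)// -(near (fgn _ Ux) y)//.
  by near: y; exact: differentiable_approx.
by apply: (IH ('D_v f)) => // x Ux; apply/near_eq_derive/fgn.
Unshelve. all: by end_near. Qed.

Lemma Ck_cst (W : normedModType R) k U (a : W) : Ck k U (cst a).
Proof.
elim: k a => [|k IH] a /=; first by move=> x _; exact: cst_continuous.
split=> // v; rewrite (_ : 'D_v _ = cst 0); first exact: IH.
by apply/funext => x; rewrite derive_cst.
Qed.

Lemma Ck_id k U : Ck k U (id : V -> V).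
Proof.
case: k => [|k]; first by move=> x _; exact: cvg_id.
split=> // v; rewrite (_ : 'D_v _ = cst v); first exact: Ck_cst.
by apply/funext => x; rewrite derive_id.
Qed.

Lemma CkD (W : normedModType R) k U (f g : V -> W) :
  open U -> Ck k U f -> Ck k U g -> Ck k U (f + g).
Proof.
move=> oU; elim: k f g => [|k IH] f g.
  by move=> fc gc x Ux; apply: continuousD; [exact: fc|exact: gc].
move=> [fd fD] [gd gD]; split=> [x Ux|v].
  by apply: differentiableD; [exact: fd|exact: gd].
apply: (@Ck_eq_on _ _ _ ('D_v f + 'D_v g)) => //; last first.
  by apply: IH; [exact: fD|exact: gD].
by move=> x Ux; rewrite deriveD//; apply: diff_derivable;
  first [exact: fd | exact: gd].
Qed.

Lemma CkN (W : normedModType R) k U (f : V -> W) :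
  open U -> Ck k U f -> Ck k U (- f).
Proof.
move=> oU; elim: k f => [|k IH] f.
  by move=> fc x Ux; apply: continuousN; exact: fc.
move=> [fd fD]; split=> [x Ux|v]; first by apply: differentiableN; exact: fd.
apply: (@Ck_eq_on _ _ _ (- 'D_v f)) => //; last exact/IH/fD.
by move=> x Ux; rewrite deriveN//; apply: diff_derivable; exact: fd.
Qed.

Lemma CkB (W : normedModType R) k U (f g : V -> W) :
  open U -> Ck k U f -> Ck k U g -> Ck k U (f - g).
Proof. by move=> oU fk gk; apply: CkD => //; exact: CkN. Qed.

Lemma CkM k U (f g : V -> R) :
  open U -> Ck k U f -> Ck k U g -> Ck k U (f * g).
Proof.
move=> oU; elim: k f g => [|k IH] f g.
  by move=> fc gc x Ux; apply: continuousM; [exact: fc|exact: gc].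
move=> fk gk; have [[fd fD] [gd gD]] := (fk, gk); split=> [x Ux|v].
  by apply: differentiableM; [exact: fd|exact: gd].
apply: (@Ck_eq_on _ _ _ (f * 'D_v g + g * 'D_v f)) => //.
  by move=> x Ux; rewrite deriveM//; apply: diff_derivable;
    first [exact: fd | exact: gd].
by apply: CkD => //; apply: IH; by [exact: CkS|exact: gD|exact: fD].
Qed.

Lemma Ck_linear (W W' : normedModType R) k U (L : {linear W -> W'})
    (f : V -> W) :
  continuous L -> open U -> Ck k U f -> Ck k U (L \o f).
Proof.
move=> Lc oU; elim: k f => [|k IH] f.
  by move=> fc x Ux; apply: continuous_comp; [exact: fc|exact: Lc].
move=> [fd fD]; split=> [x Ux|v].
  by apply: differentiable_comp; [exact: fd|exact: linear_differentiable].
apply: (@Ck_eq_on _ _ _ (L \o 'D_v f)) => //; last exact/IH/fD.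
move=> x Ux; have fdx := fd x Ux; have Ldx := linear_differentiable (f x) Lc.
rewrite /= !deriveE//; last exact: differentiable_comp.
by rewrite (diff_comp fdx Ldx) /= diff_lin.
Qed.

Lemma differentiable_coord_fun n (f : V -> 'rV[R]_n) x j :
  differentiable f x -> differentiable (fun y => f y 0 j) x.
Proof.
move=> fd.
by apply: (@differentiable_comp _ _ _ _ f (fun M : 'rV[R]_n => M 0 j) x fd);
  exact: differentiable_coord.
Qed.

Lemma derive_coord n (f : V -> 'rV[R]_n) x v j :
  differentiable f x -> 'D_v (fun y => f y 0 j) x = 'd f x v 0 j.
Proof.
by move=> fd; rewrite -(deriveE v fd) (derive_mx (diff_derivable fd)) mxE.
Qed.

Lemma Ck_coord n k U (f : V -> 'rV[R]_n) j :
  open U -> Ck k U f -> Ck k U (fun x => f x 0 j).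
Proof.
move=> oU; elim: k f => [|k IH] f.
  move=> fc x Ux.
  apply: (@continuous_comp _ _ _ f (fun M : 'rV[R]_n => M 0 j) x).
    exact: fc.
  exact: coord_continuous.
move=> [fd fD]; split=> [x Ux|v].
  exact/differentiable_coord_fun/fd.
apply: (@Ck_eq_on _ _ _ (fun x => 'D_v f x 0 j)) => //; last exact/IH/fD.
by move=> x /fd fx; rewrite (deriveE v fx) (derive_coord _ _ fx).
Qed.

Lemma differentiable_rV n (f : V -> 'rV[R]_n) x :
  (forall j, differentiable (fun y => f y 0 j) x) -> differentiable f x.
Proof.
move=> fd.
have -> : f = \sum_j (fun y => f y 0 j *: (delta_mx 0 j : 'rV[R]_n)).
  by apply/funext => y; rewrite fct_sumE [LHS]row_sum_delta.
by apply: differentiable_sum => j; exact: differentiableZl.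
Qed.

(** Reduces the smoothness of a vector-valued map to that of its coordinates,
    for which the product rule [CkM] is available. *)
Lemma Ck_rV n k U (f : V -> 'rV[R]_n) :
  open U -> (forall j, Ck k U (fun x => f x 0 j)) -> Ck k U f.
Proof.
move=> oU; elim: k f => [|k IH] f fk.
  move=> x Ux; apply/cvgrPdist_le => e e0; near=> y.
  rewrite [leLHS]/Num.Def.normr/= mx_normrE (bigmax_le _ (ltW e0))//= => -[i j] _.
  rewrite !mxE ord1 /=; move: j; near: y; apply: filter_forall => j.
  by have /cvgrPdist_le := fk j x Ux; apply.
have fd x : U x -> differentiable f x.
  by move=> Ux; apply: differentiable_rV => j; have [+ _] := fk j; apply.
split=> // v; apply: IH => j; have [_ /(_ v)] := fk j.
apply: Ck_eq_on => // x /fd fx.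
by rewrite (deriveE v fx) (derive_coord _ _ fx).
Unshelve. all: by end_near. Qed.

Lemma derive_comp_affine (V' W : normedModType R) (f : V -> W) a
    (L : {linear V' -> V}) v x :
  'D_v (fun x => f (a + L x)) x = 'D_(L v) f (a + L x).
Proof.
rewrite /derive.
have -> // : (fun h => h^-1 *: (((fun x => f (a + L x)) \o shift x) (h *: v) -
    f (a + L x))) =
  (fun h => h^-1 *: ((f \o shift (a + L x)) (h *: L v) - f (a + L x))).
by apply/funext => h /=; rewrite (linearD L) (linearZZ L) addrCA.
Qed.

Lemma Ck_comp_affine (V' W : normedModType R) k U (f : V -> W) a
    (L : {linear V' -> V}) :
  continuous L -> open U -> Ck k U f ->
  Ck k [set x | U (a + L x)] (fun x => f (a + L x)).
Proof.
move=> Lc oU; elim: k f => [|k IH] f.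
  move=> fc x Ux; apply: (@continuous_comp _ _ _ (fun x => a + L x) f).
    by apply: continuousD; [exact: cst_continuous|exact: Lc].
  exact: fc.
move=> [fd fD]; split=> [x Ux|v].
  apply: (@differentiable_comp _ _ _ _ (fun x => a + L x) f); last exact: fd.
  by apply: differentiableD => //; exact: linear_differentiable.
rewrite (_ : 'D_v _ = fun x => 'D_(L v) f (a + L x)); last first.
  by apply/funext => x; rewrite derive_comp_affine.
exact: (IH ('D_(L v) f) (fD (L v))).
Qed.

End CkTheory.

Section Differentials.
Context {R : realType} {V : normedModType R}.

Lemma diff_comp_affine (V' W : normedModType R) (f : V -> W) a
    (L : {linear V' -> V}) y w :
  continuous L -> differentiable f (a + L y) ->
  'd (fun z => f (a + L z)) y w = 'd f (a + L y) (L w).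
Proof.
move=> Lc fd; have Ld : differentiable (fun z => a + L z) y.
  by apply: differentiableD => //; exact: linear_differentiable.
have fLd : differentiable (fun z => f (a + L z)) y.
  exact: (@differentiable_comp _ _ _ _ (fun z => a + L z) f).
by rewrite -(deriveE w fLd) derive_comp_affine (deriveE _ fd).
Qed.

Lemma diff_add_scale n (A N : V -> 'rV[R]_n) (l : {linear V -> R}) v :
  continuous l ->
  differentiable A 0 -> differentiable N 0 ->
  'd (fun z => A z + l z *: N z) 0 v = 'd A 0 v + l v *: N 0.
Proof.
move=> lc Ad Nd; have ld := linear_differentiable 0 lc.
have Bjd j :
    differentiable ((fun z => A z 0 j) + (l : V -> R) * (fun z => N z 0 j)) 0.
  apply: differentiableD; first exact: differentiable_coord_fun.
  by apply: differentiableM => //; exact: differentiable_coord_fun.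
have Bj j : (fun z => (A z + l z *: N z) 0 j) =
    (fun z => A z 0 j) + (l : V -> R) * (fun z => N z 0 j).
  by apply/funext => z; rewrite !mxE.
have Bd : differentiable (fun z => A z + l z *: N z) 0.
  by apply: differentiable_rV => j; rewrite Bj.
apply/rowP => j; rewrite -(derive_coord _ _ Bd) Bj.
have Ajd := differentiable_coord_fun j Ad.
have Njd := differentiable_coord_fun j Nd.
rewrite (deriveD (diff_derivable Ajd) (diff_derivable (differentiableM ld Njd))).
rewrite (deriveM (diff_derivable ld) (diff_derivable Njd)).
rewrite derive_coord// (deriveE _ ld) diff_lin// linear0 scale0r add0r.
by rewrite !mxE [RHS]addrC mulrC addrC.
Qed.

End Differentials.

(** * Rows and the mean value inequality *)

Section SmallRows.
Context {R : realType}.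

Definition row2 (s t : R) : 'rV[R]_2 := \row_j [:: s; t]`_j.

Lemma row2E0 s t : row2 s t 0 0 = s. Proof. by rewrite mxE. Qed.
Lemma row2E1 s t : row2 s t 0 1 = t. Proof. by rewrite mxE. Qed.

Lemma ord2P (j : 'I_2) : j = 0 \/ j = 1.
Proof. by case: j => [[|[|//]] jlt]; [left|right]; exact: val_inj. Qed.

Lemma row2P (x y : 'rV[R]_2) : x 0 0 = y 0 0 -> x 0 1 = y 0 1 -> x = y.
Proof. by move=> h0 h1; apply/rowP => j; case: (ord2P j) => ->. Qed.

Lemma ord3P (j : 'I_3) : [\/ j = 0, j = 1 | j = 2].
Proof.
case: j => [[|[|[|//]]] jlt]; [apply: Or31|apply: Or32|apply: Or33]; exact: val_inj.
Qed.

Lemma row3P (x y : 'rV[R]_3) :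
  x 0 0 = y 0 0 -> x 0 1 = y 0 1 -> x 0 2 = y 0 2 -> x = y.
Proof. by move=> h0 h1 h2; apply/rowP => j; case: (ord3P j) => ->. Qed.

Definition row3 (c0 c1 c2 : R) : 'rV[R]_3 := \row_j [:: c0; c1; c2]`_j.

Lemma row3E0 c0 c1 c2 : row3 c0 c1 c2 0 0 = c0. Proof. by rewrite mxE. Qed.
Lemma row3E1 c0 c1 c2 : row3 c0 c1 c2 0 1 = c1. Proof. by rewrite mxE. Qed.
Lemma row3E2 c0 c1 c2 : row3 c0 c1 c2 0 2 = c2. Proof. by rewrite mxE. Qed.
Definition row3E := (row3E0, row3E1, row3E2).

Definition along (b z : 'rV[R]_2) : 'rV[R]_2 := z 0 0 *: b.

Fact along_is_linear b : linear (along b).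
Proof. by move=> c x y; rewrite /along !mxE scalerDl scalerA. Qed.

HB.instance Definition _ b := GRing.isLinear.Build R 'rV[R]_2 'rV[R]_2 _
  (along b) (along_is_linear b).

End SmallRows.

Section MeanValue.
Context {R : realType} {V : normedModType R}.

Lemma is_derive_line (W : normedModType R) (g : V -> W) (w v : V) (t : R) :
  differentiable g (w + t *: v) ->
  is_derive t (1 : R) (fun s : R => g (w + s *: v)) ('d g (w + t *: v) v).
Proof.
move=> gd; pose l := fun s : R => w + s *: v.
have dl : is_diff t l (0 + *:%R^~ v).
  exact: (is_diffD (is_diff_cst w t) (is_diff_scalel t v)).
have dgl : is_diff t (g \o l) ('d g (l t) \o (0 + *:%R^~ v)).
  by apply: is_diff_comp; exact: differentiableP.
have -> : 'd g (w + t *: v) v = 'd (g \o l) t 1.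
  by rewrite diff_val /= add0r scale1r.
by rewrite -deriveE//; apply: derivableP; exact: diff_derivable.
Qed.

Lemma mean_value (g : V -> R) (w v : V) :
  (forall t : R, 0 <= t <= 1 -> differentiable g (w + t *: v)) ->
  exists2 t : R, 0 < t < 1 & g (w + v) - g w = 'd g (w + t *: v) v.
Proof.
move=> gd; pose phi (s : R) := g (w + s *: v).
have phid (t : R) : 0 <= t <= 1 -> is_derive t (1 : R) phi ('d g (w + t *: v) v).
  by move=> t01; apply: is_derive_line; exact: gd.
have [||t] := @MVT R phi (fun t : R => 'd g (w + t *: v) v) 0 1 ltr01.
- by move=> t; rewrite in_itv /= => /andP[t0 t1]; apply: phid; rewrite !ltW.
- apply: derivable_within_continuous => t; rewrite in_itv /= => /phid H.
  exact: ex_derive.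
- rewrite in_itv /= => t01; rewrite /phi scale1r scale0r addr0 subr0 mulr1 => e.
  by exists t.
Qed.

End MeanValue.

Section RowVectors.
Context {R : realType}.

Lemma coord_le_norm n (x : 'rV[R]_n) j : `|x 0 j| <= `|x|.
Proof.
by rewrite [leRHS]/Num.Def.normr/= mx_normrE; exact: (le_bigmax _ _ (0, j)).
Qed.

Lemma norm_rV_le n (x : 'rV[R]_n) C :
  0 <= C -> (forall j, `|x 0 j| <= C) -> `|x| <= C.
Proof.
move=> C0 xC; rewrite [leLHS]/Num.Def.normr/= mx_normrE bigmax_le//= => -[i j] _.
by rewrite ord1.
Qed.

Lemma linear_rV_continuous n (W : normedModType R) (L : {linear 'rV[R]_n -> W}) :
  continuous L.
Proof.
move=> x; apply: differentiable_continuous.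
have -> : (L : _ -> _) = \sum_j (fun v : 'rV[R]_n => v 0 j *: L (delta_mx 0 j)).
  apply/funext => v; rewrite fct_sumE [in LHS](row_sum_delta v) linear_sum.
  by apply: eq_bigr => j _; rewrite linearZ.
by apply: differentiable_sum => j; apply: differentiableZl; exact: differentiable_coord.
Qed.

Lemma mean_value_rV (V : normedModType R) n (g : V -> 'rV[R]_n) w v C :
  (forall t : R, 0 <= t <= 1 -> differentiable g (w + t *: v)) ->
  (forall t : R, 0 <= t <= 1 -> `|'d g (w + t *: v) v| <= C) ->
  `|g (w + v) - g w| <= C.
Proof.
move=> gd gC; have C0 : 0 <= C.
  by apply: le_trans (normr_ge0 _) (gC 0 _); rewrite lexx ler01.
apply: norm_rV_le => // j.
have [|t /andP[t0 t1]] := @mean_value _ _ (fun x => g x 0 j) w v.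
  by move=> t /gd; exact: differentiable_coord_fun.
have t01 : 0 <= t <= 1 by rewrite !ltW.
have gt := gd t t01.
rewrite !mxE => ->; apply: le_trans (gC t t01).
apply: le_trans (coord_le_norm _ j).
by rewrite -(derive_coord _ _ gt) (deriveE _ (differentiable_coord_fun j gt)).
Qed.

End RowVectors.

Section Rectangle.
Context {R : realType}.

Lemma rectangle_ball (d : R) :
  0 < d -> rectangle (- d) d (- d) d = ball (0 : 'rV[R]_2) d.
Proof.
move=> d0; apply/seteqP; split => [z /= [z0 z1]|z].
  split => // i j; rewrite ord1 mxE /ball /= sub0r normrN ltr_norml.
  by case: (ord2P j) => ->.
rewrite -ball_normE /= sub0r normrN => zd.
by split; rewrite -ltr_norml; exact: le_lt_trans (coord_le_norm _ _) zd.
Qed.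

End Rectangle.

(** * Local inversion *)

Section LocalHomeo.
Context {R : realType}.

Lemma ball_segment (V : normedModType R) (z : V) r w v (t : R) :
  ball z r w -> ball z r (w + v) -> 0 <= t <= 1 -> ball z r (w + t *: v).
Proof.
rewrite -!ball_normE /= => wr vr /andP[t0 t1].
have -> : z - (w + t *: v) = (1 - t) *: (z - w) + t *: (z - (w + v)).
  by rewrite !opprD !addrA [t *: (_ - v)]scalerBr addrA -scalerDl subrK scale1r.
apply: le_lt_trans (ler_normD _ _) _; rewrite !normrZ.
rewrite ger0_norm ?subr_ge0// ger0_norm//.
have [->|tn0] := eqVneq t 0; first by rewrite subr0 mul1r mul0r addr0.
have tp : 0 < t by rewrite lt_def tn0.
have := ltW wr; nra.
Qed.

(** Topological part of the inverse function theorem.  Composing [f] with the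
    inverse of its differential at [z0] gives a perturbation of the identity by
    a map [h] of Lipschitz constant 1/2 near [z0], hence the lower bound.  To
    solve [f w = y] near a given [w0], minimize the residual over a small closed
    ball: a Newton step from the minimizer stays in the ball and halves the
    residual, so the minimum is 0. *)
Lemma local_homeo n (f : 'rV[R]_n -> 'rV[R]_n) (U : set 'rV[R]_n) z0 :
  open U -> U z0 -> Ck 1 U f -> injective ('d f z0) ->
  exists r c : R, [/\ 0 < r, 0 < c, ball z0 r `<=` U,
    forall z z', ball z0 r z -> ball z0 r z' -> c * `|z - z'| <= `|f z - f z'|
  & forall O, open O -> O `<=` ball z0 r -> open (f @` O)].
Proof.
move=> oU Uz0 [fd fD] finj.
pose M := lin1_mx ('d f z0).
have MU : M \in unitmx.
  rewrite -row_free_unit; apply/inj_row_free => v; rewrite mul_rV_lin1.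
  by rewrite -[0 in RHS](linear0 ('d f z0)) => /finj.
pose B := invmx M.
pose N := mulmxr B : {linear 'rV[R]_n -> 'rV[R]_n}.
have [C C0 NC] := linear_lipschitz (@linear_rV_continuous _ _ _ N).
have N_inj x : N x = 0 -> x = 0.
  by move=> /= /(congr1 (mulmx^~ M)); rewrite mul0mx mulmxKV.
pose eta : R := (2 * n.+1%:R)^-1.
have eta0 : 0 < eta by rewrite invr_gt0 mulr_gt0.
have near0 : \forall w \near z0, U w /\
    forall i, `|N ('D_(delta_mx 0 i) f w) - delta_mx 0 i| <= eta.
  near=> w; split; first by near: w; exact: open_nbhs_nbhs.
  move=> i; move: i; near: w; apply: filter_forall => i.
  have : {for z0, continuous (N \o 'D_(delta_mx 0 i) f)}.
    apply: continuous_comp; first exact: fD.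
    exact: linear_rV_continuous.
  move=> /cvgrPdist_le /(_ _ eta0); apply: filterS => w.
  rewrite distrC; suff -> : (N \o 'D_(delta_mx 0 i) f) z0 = delta_mx 0 i by [].
  rewrite /= deriveE; last by apply: fd.
  by rewrite -(mul_rV_lin1 ('d f z0)) mulmxK.
have [r /= r0 rU] := (nbhs_ballP _ _).1 near0.
have dfN w v : ball z0 r w -> `|N ('d f w v) - v| <= 2^-1 * `|v|.
  move=> /rU[Uw Dw].
  have -> : N ('d f w v) - v =
      \sum_i v 0 i *: (N ('D_(delta_mx 0 i) f w) - delta_mx 0 i).
    under eq_bigr do rewrite scalerBr.
    rewrite sumrB -row_sum_delta; congr (_ - _).
    rewrite [in LHS](row_sum_delta v) !linear_sum; apply: eq_bigr => i _.
    by rewrite !linearZ /= deriveE//; exact: fd.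
  apply: le_trans (ler_norm_sum _ _ _) _.
  apply: (@le_trans _ _ (\sum_(i < n) eta * `|v|)).
    apply: ler_sum => i _; rewrite normrZ mulrC ler_pM//; first exact: Dw.
    exact: coord_le_norm.
  rewrite sumr_const card_ord -mulrnAl ler_wpM2r// -mulr_natl.
  rewrite /eta invfM mulrCA ler_piMr//.
  by rewrite ler_pdivrMr// mul1r ler_nat.
pose h w := N (f w) - w.
have hlip w w' : ball z0 r w -> ball z0 r w' ->
    `|h w - h w'| <= 2^-1 * `|w - w'|.
  move=> rw rw'; rewrite -[in leLHS](subrKC w' w).
  have dh (t : 'rV[R]_n) : ball z0 r t -> is_diff t h (N \o 'd f t - id).
    move=> rt; apply: is_diffB.
    apply: is_diff_comp; first by apply/differentiableP/fd; have [] := rU t rt.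
    apply: DiffDef; last exact/diff_lin/linear_rV_continuous.
    exact/linear_differentiable/linear_rV_continuous.
  have seg (t : R) : 0 <= t <= 1 -> ball z0 r (w' + t *: (w - w')).
    by move=> t01; apply: ball_segment => //; rewrite subrKC.
  apply: mean_value_rV => t t01; have rt := seg t t01; have dht := dh _ rt.
    exact: ex_diff.
  by rewrite diff_val; exact: dfN.
have key w w' : ball z0 r w -> ball z0 r w' -> `|w - w'| <= 2 * `|N (f w - f w')|.
  move=> rw rw'; have H := hlip _ _ rw rw'.
  have : `|w - w'| <= `|N (f w - f w')| + `|h w - h w'|.
    have -> : w - w' = N (f w - f w') - (h w - h w').
      rewrite (linearB N) /h; move: (N (f w)) (N (f w')) => a a'.
      by apply/rowP => j; rewrite !mxE; ring.
    exact: ler_normB.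
  lra.
exists r, (2 * C)^-1; split => //.
- by rewrite invr_gt0 mulr_gt0.
- by move=> w /rU[].
- move=> w w' rw rw'; rewrite ler_pdivrMl ?mulr_gt0// -mulrA.
  by apply: le_trans (key _ _ rw rw') _; rewrite ler_wpM2l// NC.
move=> O oO Or; rewrite openE => _ [w0 Ow0 <-].
have [rho /= rho0 rhoO] : nbhs_ball w0 O.
  by apply/nbhs_ballP; exact: open_nbhs_nbhs.
have rho2 : 0 < rho / 2 by rewrite divr_gt0.
pose A := closed_ball w0 (rho / 2).
have AE w : A w <-> `|w0 - w| <= rho / 2 by rewrite /A closed_ballE.
have AO : A `<=` O.
  move=> w /AE Aw; apply: rhoO; rewrite -ball_normE /=.
  by apply: le_lt_trans Aw _; rewrite ltr_pdivrMr// ltr_pMr// ltr1n.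
have cA : compact A.
  apply: bounded_closed_compact; last exact: closed_ball_closed.
  exists (`|w0| + rho / 2); split; first exact: num_real.
  move=> x hx w /AE Aw; apply: le_trans (ltW hx).
  by rewrite -[w](subKr w0) (le_trans (ler_normB _ _))// lerD2l.
(* For [y] within [d] of [f w0] the residual at [w0] is less than [rho / 20].
   The minimizer is within 4 times that residual of [w0], and the Newton step
   adds at most 1, so it ends within [rho / 2] of [w0]. *)
pose d := rho / (20 * C).
have d0 : 0 < d by rewrite divr_gt0// mulr_gt0.
apply/nbhs_ballP; exists d => //= y; rewrite -ball_normE /= => yd.
pose phi w := `|N (f w - y)|.
have phi0 : phi w0 < rho / 20.
  apply: le_lt_trans (NC _) _.
  by rewrite mulrC -ltr_pdivlMr// -mulrA -invfM.
have cphi : {within A, continuous phi}.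
  apply: continuous_in_subspaceT => w; rewrite inE => /AO/Or/rU[Uw _].
  apply: (@continuous_comp _ _ _ (fun w => N (f w - y)) Num.norm);
    last exact: norm_continuous.
  apply: (@continuous_comp _ _ _ (fun w => f w - y) N);
    last exact: linear_rV_continuous.
  apply: continuousB; last exact: cst_continuous.
  exact/differentiable_continuous/fd.
have Aw0 : A w0 by apply/AE; rewrite subrr normr0 ltW.
have [|w] := EVT_min_rV _ cA cphi; first by exists w0.
rewrite inE => Aw wmin.
have phiw : phi w <= phi w0 by apply: wmin; rewrite inE.
exists w; first exact: AO.
pose w' := w - N (f w - y).
have ww0 : `|w0 - w| <= 4 * phi w0.
  apply: le_trans (key _ _ (Or _ Ow0) (Or _ (AO _ Aw))) _.
  have -> : N (f w0 - f w) = N (f w0 - y) - N (f w - y).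
    by rewrite -linearB; congr (N _); apply/rowP => j; rewrite !mxE; ring.
  have := ler_normB (N (f w0 - y)) (N (f w - y)); rewrite -/(phi w0) -/(phi w).
  lra.
have Aw' : A w'.
  apply/AE; rewrite /w' opprB addrCA addrC.
  apply: le_trans (ler_normD _ _) _; rewrite -/(phi w).
  lra.
have : phi w <= phi w' by apply: wmin; rewrite inE.
have phiw' : phi w' <= 2^-1 * phi w.
  have -> : phi w' = `|h w' - h w|.
    have -> : h w' = N (f w') - (w - N (f w - y)) by [].
    congr (`|_|); rewrite /h !(linearB N).
    move: (N (f w)) (N (f w')) (N y) => a a' b.
    by apply/rowP => j; rewrite !mxE; ring.
  apply: le_trans (hlip _ _ (Or _ (AO _ Aw')) (Or _ (AO _ Aw))) _.
  by rewrite /w' addrAC subrr add0r normrN.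
move=> ww'; have : phi w <= 0 by lra.
by rewrite /phi normr_le0 => /eqP/N_inj/eqP; rewrite subr_eq0 => /eqP.
Unshelve. all: by end_near. Qed.

End LocalHomeo.

Section LowerLipschitz.
Context {R : realType} {V W : normedModType R}.
Variables (D : set V) (g : V -> W) (c : R).
Hypothesis c0 : 0 < c.
Hypothesis gc : forall x y, D x -> D y -> c * `|x - y| <= `|g x - g y|.

Lemma lower_lipschitz_inj x y : D x -> D y -> g x = g y -> x = y.
Proof.
move=> Dx Dy gxy; have := gc Dx Dy.
rewrite gxy subrr normr0 pmulr_rle0// normr_le0 subr_eq0.
by move/eqP.
Qed.

(** A vector killed by the differential would give an increment of [g] of size
    [o(t)] for a step of size [t]. *)
Lemma lower_lipschitz_diff_inj x : open D -> D x -> differentiable g x ->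
  injective ('d g x).
Proof.
move=> oD Dx gx a b ab; apply/eqP; rewrite -subr_eq0; apply/negPn/negP => v0.
pose v := a - b.
have dv : 'd g x v = 0 by rewrite /v linearB ab subrr.
have c2 : 0 < c / 2 by rewrite divr_gt0.
have near_x : \forall y \near x, D y /\
    `|g y - g x - 'd g x (y - x)| <= c / 2 * `|y - x|.
  near=> y; split; first by near: y; exact: open_nbhs_nbhs.
  by near: y; exact: differentiable_approx.
have /nbhs_ballP[d /= d0 dx] := near_x.
have nv0 : 0 < `|v| by rewrite normr_gt0.
pose t := d / (2 * `|v|).
have t0 : 0 < t by rewrite divr_gt0 ?mulr_gt0.
have tv : `|t *: v| = d / 2.
  by rewrite normrZ gtr0_norm// /t invfM mulrA mulfVK ?gt_eqF.
have xK : x + t *: v - x = t *: v by rewrite addrAC subrr add0r.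
have := dx (x + t *: v); rewrite -ball_normE /= distrC xK tv.
rewrite ltr_pdivrMr// ltr_pMr// ltr1n => /(_ isT)[Dxt].
rewrite linearZ /= dv scaler0 subr0 => H.
have := gc Dxt Dx; rewrite xK tv.
have : 0 < c * d by rewrite mulr_gt0.
lra.
Unshelve. all: by end_near. Qed.

Lemma lower_lipschitz_inverse : D !=set0 ->
  exists2 h : W -> V, (forall x, D x -> h (g x) = x) &
    {within g @` D, continuous h}.
Proof.
move=> [x0 Dx0].
pose h y := xget x0 [set x | D x /\ g x = y].
have hg x : D x -> h (g x) = x.
  move=> Dx; rewrite /h; case: xgetP => [y _ [Dy gy]|/(_ x)].
    exact: lower_lipschitz_inj.
  by move=> H; exfalso; apply: H.
exists h => //.
apply/subspace_continuousP => _ [x Dx <-].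
apply/cvgrPdist_lt => e e0; rewrite /= near_withinE.
apply/nbhs_ballP; exists (c * e); first by rewrite /= mulr_gt0.
move=> q /= + [y Dy yq]; rewrite /from_subspace -{}yq !hg// -ball_normE /=.
rewrite -[`|x - y| < e](ltr_pM2l c0); apply: le_lt_trans; exact: gc.
Qed.

End LowerLipschitz.

(** Here [m] is the value of a functional of norm [C] on an error term of size
    [D], itself [o(n)], and [q] bounds [n] from above up to the factor [c]. *)
Lemma rescaled_error (R : realFieldType) (e c k C m D n q : R) :
  0 < c -> 0 < k -> 0 < C -> 0 < e ->
  m <= C * D -> D <= e * c * k / C * n -> c * n <= q -> k^-1 * m <= e * q.
Proof.
move=> c0 k0 C0 e0 mCD Dn nq; rewrite ler_pdivrMl//.
apply: (le_trans mCD); apply: (@le_trans _ _ (C * (e * c * k / C * n))).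
  by rewrite ler_wpM2l// ltW.
rewrite (_ : C * _ = k * (e * (c * n))); last by field; rewrite gt_eqF.
by rewrite !ler_wpM2l// ltW.
Qed.

(** * The eikonal equation in the plane *)

Section Euclidean.
Context {R : realType}.
Implicit Types (x y v w : 'rV[R]_2) (t : R).

(** The norm of ['rV_2] is the sup norm, while the gradient of the graph function
    is a unit vector for the Euclidean norm [enorm]. *)
Definition dot x y : R := x 0 0 * y 0 0 + x 0 1 * y 0 1.
Definition enorm x : R := Num.sqrt (dot x x).

Lemma dotDr x y v : dot x (y + v) = dot x y + dot x v.
Proof. by rewrite /dot !mxE; ring. Qed.

Lemma dotZr t x y : dot x (t *: y) = t * dot x y.
Proof. by rewrite /dot !mxE; ring. Qed.

Lemma dotZl t x y : dot (t *: x) y = t * dot x y.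
Proof. by rewrite /dot !mxE; ring. Qed.

Lemma dotxx_ge0 x : 0 <= dot x x.
Proof. by rewrite /dot -!expr2 addr_ge0 ?sqr_ge0. Qed.

Lemma enorm_ge0 x : 0 <= enorm x. Proof. exact: sqrtr_ge0. Qed.

Lemma sqr_enorm x : enorm x ^+ 2 = dot x x.
Proof. by rewrite sqr_sqrtr ?dotxx_ge0. Qed.

Lemma enorm_le x C : 0 <= C -> (enorm x <= C) = (dot x x <= C ^+ 2).
Proof. by move=> C0; rewrite -sqr_enorm ler_sqr ?nnegrE ?enorm_ge0. Qed.

Lemma enorm0 : enorm 0 = 0.
Proof. by rewrite /enorm /dot !mxE !mul0r addr0 sqrtr0. Qed.

Lemma enormZ t x : enorm (t *: x) = `|t| * enorm x.
Proof.
rewrite /enorm (_ : dot _ _ = t ^+ 2 * dot x x); last first.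
  by rewrite /dot !mxE; ring.
by rewrite sqrtrM ?sqr_ge0// sqrtr_sqr.
Qed.

Lemma dot_le_enorm x y : dot x y <= enorm x * enorm y.
Proof.
have [|d0] := leP (dot x y) 0.
  by move=> /le_trans; apply; rewrite mulr_ge0 ?enorm_ge0.
rewrite -ler_sqr ?nnegrE ?mulr_ge0 ?enorm_ge0 ?(ltW d0)//.
rewrite exprMn !sqr_enorm -subr_ge0.
rewrite (_ : _ - _ = (x 0 0 * y 0 1 - x 0 1 * y 0 0) ^+ 2) ?sqr_ge0//.
by rewrite /dot; ring.
Qed.

Lemma enormD x y : enorm (x + y) <= enorm x + enorm y.
Proof.
rewrite enorm_le ?addr_ge0 ?enorm_ge0//.
rewrite (_ : dot _ _ = dot x x + dot y y + 2 * dot x y); last first.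
  by rewrite /dot !mxE; ring.
by rewrite -!sqr_enorm; have := dot_le_enorm x y; nra.
Qed.

Lemma norm_le_enorm x : `|x| <= enorm x.
Proof.
apply: norm_rV_le; first exact: enorm_ge0.
move=> j; rewrite -ler_sqr ?nnegrE ?enorm_ge0// sqr_enorm -normrX ger0_norm ?sqr_ge0//.
case: (ord2P j) => ->.
- by rewrite /dot -!expr2 lerDl sqr_ge0.
- by rewrite /dot -!expr2 lerDr sqr_ge0.
Qed.

Lemma enorm_continuous : continuous enorm.
Proof.
move=> x; apply: (@continuous_comp _ _ _ (fun x => dot x x) Num.sqrt);
  last exact: sqrt_continuous.
by apply: continuousD; apply: continuousM; exact: coord_continuous.
Qed.

Definition disc x (r : R) : set 'rV[R]_2 := [set y | enorm (y - x) <= r].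

Lemma compact_disc x r : compact (disc x r).
Proof.
apply: bounded_closed_compact.
  exists (`|x| + r); split; first exact: num_real.
  move=> M hM y /= Dy; apply: le_trans (ltW hM).
  rewrite -[y](subrKC x) (le_trans (ler_normD _ _))// lerD2l.
  exact: le_trans (norm_le_enorm _) Dy.
apply: (@closed_comp _ _ (fun y => enorm (y - x)) [set t | t <= r]);
  last exact: closed_le.
move=> y _; apply: (@continuous_comp _ _ _ (fun y => y - x) enorm);
  last exact: enorm_continuous.
by apply: continuousB; [exact: cvg_id|exact: cst_continuous].
Qed.

Lemma disc_convex x r y v t : disc x r y -> disc x r (y + v) -> 0 <= t <= 1 ->
  disc x r (y + t *: v).
Proof.
rewrite /disc /= => Dy Dv /andP[t0 t1].
have -> : y + t *: v - x = (1 - t) *: (y - x) + t *: (y + v - x).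
  by apply/rowP => j; rewrite !mxE; ring.
apply: le_trans (enormD _ _) _; rewrite !enormZ.
rewrite ger0_norm ?subr_ge0// ger0_norm//.
nra.
Qed.

End Euclidean.

Section EikonalRay.
Context {R : realType}.
Implicit Types (y z v : 'rV[R]_2) (t : R).
Variables (u : 'rV[R]_2 -> R) (p : 'rV[R]_2 -> 'rV[R]_2) (x : 'rV[R]_2) (r : R).
Hypothesis r0 : 0 < r.
Hypothesis ud : forall y, disc x r y -> differentiable u y.
Hypothesis up : forall y v, disc x r y -> 'd u y v = dot (p y) v.
Hypothesis p1 : forall y, disc x r y -> enorm (p y) = 1.

Lemma eikonal_lipschitz y z : disc x r y -> disc x r z ->
  u z - u y <= enorm (z - y).
Proof.
move=> Dy Dz; have seg (t : R) : 0 <= t <= 1 -> disc x r (y + t *: (z - y)).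
  by move=> t01; apply: disc_convex => //; rewrite subrKC.
have [t t01|t /andP[t0 t1]] := @mean_value _ _ u y (z - y); first exact/ud/seg.
have Dt : disc x r (y + t *: (z - y)) by apply: seg; rewrite !ltW.
rewrite subrKC => ->; rewrite up//; apply: le_trans (dot_le_enorm _ _) _.
by rewrite p1// mul1r.
Qed.

Let disc_center : disc x r x.
Proof. by rewrite /disc /= subrr enorm0 ltW. Qed.

Let u_continuous : {within disc x r, continuous u}.
Proof.
apply: continuous_in_subspaceT => y; rewrite inE => Dy.
exact/differentiable_continuous/ud.
Qed.

(** At a maximum point [y] of [u - (1 - e) |. - x|] interior to the disc, a step
    of length [t] along [p y] would increase [u] by [t - o(t)] and the
    distance to [x] by at most [t], so the function by at least
    [e t - o(t) > 0].  Hence the maximum is on the boundary circle. *)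
Lemma eikonal_growth e : 0 < e < 1 ->
  exists2 y, disc x r y & u x + (1 - e) * r <= u y.
Proof.
move=> /andP[e0 e1]; pose h y := u y - (1 - e) * enorm (y - x).
have ch : {within disc x r, continuous h}.
  apply: continuous_in_subspaceT => y; rewrite inE => Dy.
  apply: (@continuousB _ _ _ u (fun y => (1 - e) * enorm (y - x))).
    exact/differentiable_continuous/ud.
  apply: continuousM; first exact: cst_continuous.
  apply: (@continuous_comp _ _ _ (fun y => y - x) enorm);
    last exact: enorm_continuous.
  by apply: continuousB; [exact: cvg_id|exact: cst_continuous].
have [|y] := EVT_max_rV _ (@compact_disc _ x r) ch; first by exists x.
rewrite inE => Dy hmax; exists y => //.
have hxy : h x <= h y by apply: hmax; rewrite inE.
rewrite /h subrr enorm0 mulr0 subr0 in hxy.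
have [yr|yr] := leP r (enorm (y - x)); first by nra.
exfalso.
have e2 : 0 < e / 2 by rewrite divr_gt0.
have /nbhs_ballP[d /= d0 dy] := differentiable_approx (ud Dy) e2.
pose t := Num.min (d / 2) (r - enorm (y - x)).
have t0 : 0 < t by rewrite lt_min divr_gt0//= subr_gt0.
have td : t < d by rewrite /t gt_min ltr_pdivrMr// ltr_pMr// ltr1n.
have tr : t <= r - enorm (y - x) by rewrite /t ge_min lexx orbT.
pose y' := y + t *: p y.
have y'y : y' - y = t *: p y by rewrite /y' addrC addKr.
have ny'y : `|y' - y| <= t.
  by apply: le_trans (norm_le_enorm _) _; rewrite y'y enormZ p1// mulr1 gtr0_norm.
have ey' : enorm (y' - x) <= enorm (y - x) + t.
  rewrite (_ : y' - x = (y - x) + t *: p y); last by rewrite /y' addrAC.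
  by apply: le_trans (enormD _ _) _; rewrite enormZ p1// mulr1 gtr0_norm.
have Dy' : disc x r y' by rewrite /disc /=; lra.
have : h y' <= h y by apply: hmax; rewrite inE.
have := dy y'; rewrite -ball_normE /= distrC => /(_ (le_lt_trans ny'y td)).
rewrite up// y'y (_ : dot _ _ = t * enorm (p y) ^+ 2); last first.
  by rewrite sqr_enorm /dot !mxE; ring.
rewrite p1// expr1n mulr1 -y'y ler_norml => /andP[+ _].
have : e / 2 * `|y' - y| <= e / 2 * t by rewrite ler_wpM2l// ltW.
rewrite /h; nra.
Qed.

(** The point [y] where [u] is maximal on the disc has [u y = u x + r] by
    [eikonal_growth]; the Lipschitz bound then forces [u] to have slope 1 along
    the segment from [x] to [y], so the unit vector [p x] has scalar product 1
    with its direction and equals it. *)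
Lemma eikonal_ray : u (x + r *: p x) = u x + r.
Proof.
have [|y] := EVT_max_rV _ (@compact_disc _ x r) u_continuous; first by exists x.
rewrite inE => Dy umax.
have uy : u x + r <= u y.
  apply/ler_addgt0Pr => e e0.
  pose e' := Num.min (2^-1) (e / r).
  have e'01 : 0 < e' < 1.
    rewrite lt_min invr_gt0 ltr0n divr_gt0//= gt_min.
    by rewrite invf_lt1 ?ltr1n.
  have e'r : e' * r <= e by rewrite -ler_pdivlMr// ge_min lexx orbT.
  have [z Dz uz] := eikonal_growth e'01.
  have : u z <= u y by apply: umax; rewrite inE.
  lra.
pose e := r^-1 *: (y - x).
have ye : y = x + r *: e by rewrite /e scalerA divff ?gt_eqF// scale1r subrKC.
have Dyx := eikonal_lipschitz disc_center Dy.
have e1 : enorm e <= 1.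
  by rewrite /e enormZ gtr0_norm ?invr_gt0// mulrC ler_pdivrMr// mul1r.
have xK v : x + v - x = v by rewrite addrAC subrr add0r.
have ut t : 0 <= t <= r -> u (x + t *: e) = u x + t.
  move=> /andP[t0 tr]; have Dt : disc x r (x + t *: e).
    rewrite /disc /= xK enormZ ger0_norm//.
    by apply: le_trans (ler_wpM2l t0 e1) _; rewrite mulr1.
  have := eikonal_lipschitz disc_center Dt.
  have := eikonal_lipschitz Dt Dy.
  rewrite xK enormZ ger0_norm//.
  rewrite (_ : y - _ = (r - t) *: e); last first.
    by rewrite [y in LHS]ye; apply/rowP => j; rewrite !mxE; ring.
  rewrite enormZ ger0_norm ?subr_ge0// => H1 H2.
  have H3 : t * enorm e <= t by rewrite ler_piMr.
  have H4 : (r - t) * enorm e <= r - t by rewrite ler_piMr// subr_ge0.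
  lra.
have pe : 1 <= dot (p x) e.
  apply/ler_addgt0Pr => d d0.
  have /nbhs_ballP[d' /= d'0 dx] := differentiable_approx (ud disc_center) d0.
  pose t := Num.min (d' / 2) r.
  have t0 : 0 < t by rewrite lt_min divr_gt0.
  have td : t < d' by rewrite /t gt_min ltr_pdivrMr// ltr_pMr// ltr1n.
  have tr : t <= r by rewrite /t ge_min lexx orbT.
  have nte : `|t *: e| <= t.
    apply: le_trans (norm_le_enorm _) _; rewrite enormZ gtr0_norm//.
    by rewrite ler_piMr// ltW.
  have := dx (x + t *: e); rewrite -ball_normE /= distrC xK.
  move=> /(_ (le_lt_trans nte td)).
  rewrite ut ?tr ?(ltW t0)// up// (_ : dot _ _ = t * dot (p x) e); last first.
    by rewrite /dot !mxE; ring.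
  rewrite [u x + t]addrC addrK ler_norml => /andP[_ H].
  have : t * (1 - dot (p x) e) <= t * d.
    rewrite mulrBr mulr1 (le_trans H)// mulrC ler_wpM2r// ltW//.
  rewrite ler_pM2l//; lra.
suff -> : p x = e.
  by rewrite -ye; apply/eqP; rewrite eq_le uy andbT -lerBlDl (le_trans Dyx).
apply/eqP; rewrite -subr_eq0; apply/eqP.
have q0 : dot (p x - e) (p x - e) <= 0.
  rewrite (_ : dot _ _ = dot (p x) (p x) + dot e e - 2 * dot (p x) e); last first.
    by rewrite /dot !mxE; ring.
  rewrite -!sqr_enorm p1// expr1n.
  have : enorm e ^+ 2 <= 1 by rewrite expr_le1 ?enorm_ge0.
  lra.
apply/eqP; rewrite -normr_le0; apply: le_trans (norm_le_enorm _) _.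
by rewrite enorm_le// expr0n.
Qed.

End EikonalRay.

(** For negative times [eikonal_ray] is applied to [- u]. *)
Lemma eikonal_line (R : realType) (u : 'rV[R]_2 -> R) (p : 'rV[R]_2 -> 'rV[R]_2)
    (x : 'rV[R]_2) (r t : R) :
  (forall y, disc x r y -> [/\ differentiable u y,
     forall v, 'd u y v = dot (p y) v & enorm (p y) = 1]) ->
  `|t| <= r -> u (x + t *: p x) = u x + t.
Proof.
move=> H tr.
have sD y : disc x `|t| y -> disc x r y by move=> /le_trans; apply.
have [t0|t0|->] := ltgtP t 0; last by rewrite scale0r !addr0.
- have T0 : 0 < - t by rewrite oppr_gt0.
  have sDt y : disc x (- t) y -> disc x r y by rewrite -ltr0_norm//; exact: sD.
  have E : (- u) (x + (- t) *: (- p) x) = (- u) x - t.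
    apply: eikonal_ray => //.
    + by move=> y /sDt /H[ud _ _]; exact: differentiableN.
    + move=> y v /sDt /H[ud up _]; rewrite diffN//= -[LHS]/(- 'd u y v) up /dot.
      by rewrite -[(- p) y]/(- p y) !mxE; ring.
    + move=> y /sDt /H[_ _]; rewrite -[(- p) y]/(- p y) -scaleN1r enormZ.
      by rewrite normrN1 mul1r.
  move: E; rewrite -[(- p) x]/(- p x) scaleNr scalerN opprK.
  by rewrite -[LHS]/(- u _) -[(- u) x]/(- u x) -opprD => /oppr_inj.
- have sDt y : disc x t y -> disc x r y by rewrite -{1}(gtr0_norm t0); exact: sD.
  apply: (@eikonal_ray R u p x t t0).
  + by move=> y /sDt /H[].
  + by move=> y v /sDt /H[].
  + by move=> y /sDt /H[].
Qed.

(** * Null vectors in Minkowski space *)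

Section Minkowski.
Context {R : realType}.
Implicit Types (a b k v w x y : 'rV[R]_3).

(** The Euclidean cross product with its time component negated: it is
    orthogonal to [a] and [b] for [mink]. *)
Definition lcross a b : 'rV[R]_3 :=
  row3 (a 0 2 * b 0 1 - a 0 1 * b 0 2)
       (a 0 2 * b 0 0 - a 0 0 * b 0 2)
       (a 0 0 * b 0 1 - a 0 1 * b 0 0).

Lemma mink_lcross_span a b s t : mink (lcross a b) (s *: a + t *: b) = 0.
Proof. by rewrite /mink !row3E !mxE; ring. Qed.

Lemma mink_lcross a b :
  mink (lcross a b) (lcross a b) = mink a b ^+ 2 - mink a a * mink b b.
Proof. by rewrite /mink !row3E; ring. Qed.

Lemma lcross_eq0 a b j : lcross a b = 0 -> b 0 j *: a = a 0 j *: b.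
Proof.
move=> n0; have n i : lcross a b 0 i = 0 by rewrite n0 mxE.
have := n 0; have := n 1; have := n 2; rewrite !row3E => n2 n1 n0'.
by apply: row3P; rewrite !mxE; case: (ord3P j) => ->; lra.
Qed.

Lemma minkDr v x y : mink v (x + y) = mink v x + mink v y.
Proof. by rewrite /mink !mxE; ring. Qed.

Lemma minkZr v c x : mink v (c *: x) = c * mink v x.
Proof. by rewrite /mink !mxE; ring. Qed.

Lemma minkNr v x : mink v (- x) = - mink v x.
Proof. by rewrite /mink !mxE; ring. Qed.

Lemma null_vector_coord0 v : null_vector v -> v 0 0 != 0.
Proof.
move=> [v0 vv]; apply: contra v0 => /eqP v00; apply/eqP.
move: vv; rewrite /mink v00 mul0r oppr0 add0r -!expr2 => /eqP.
rewrite paddr_eq0 ?sqr_ge0// !sqrf_eq0 => /andP[/eqP v1 /eqP v2].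
by apply: row3P; rewrite ?mxE.
Qed.

(** The plane [v^perp] contains [v] itself, so [mink] is degenerate on it.  In
    coordinates, [v0 a0] and [v0 b0] are determined by the horizontal parts,
    and [v0^2] times the entries [mink a a], [mink b b], [mink a b] of the Gram
    matrix are [alpha^2], [beta^2], [alpha beta]. *)
Lemma null_orthogonal_gram v a b : null_vector v -> mink v a = 0 -> mink v b = 0 ->
  mink a b ^+ 2 = mink a a * mink b b.
Proof.
move=> nv va vb; have v0 := null_vector_coord0 nv; have [_ vv] := nv.
have vsq : v 0 0 ^+ 2 = v 0 1 ^+ 2 + v 0 2 ^+ 2 by move: vv; rewrite /mink; lra.
have eva : v 0 0 * a 0 0 = v 0 1 * a 0 1 + v 0 2 * a 0 2.
  by move: va; rewrite /mink; lra.
have evb : v 0 0 * b 0 0 = v 0 1 * b 0 1 + v 0 2 * b 0 2.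
  by move: vb; rewrite /mink; lra.
pose alpha := v 0 1 * a 0 2 - v 0 2 * a 0 1.
pose beta := v 0 1 * b 0 2 - v 0 2 * b 0 1.
have aa : v 0 0 ^+ 2 * mink a a = alpha ^+ 2.
  rewrite (_ : _ * _ = - (v 0 0 * a 0 0) ^+ 2
      + v 0 0 ^+ 2 * (a 0 1 ^+ 2 + a 0 2 ^+ 2)).
    by rewrite eva vsq /alpha; ring.
  by rewrite /mink; ring.
have bb : v 0 0 ^+ 2 * mink b b = beta ^+ 2.
  rewrite (_ : _ * _ = - (v 0 0 * b 0 0) ^+ 2
      + v 0 0 ^+ 2 * (b 0 1 ^+ 2 + b 0 2 ^+ 2)).
    by rewrite evb vsq /beta; ring.
  by rewrite /mink; ring.
have ab : v 0 0 ^+ 2 * mink a b = alpha * beta.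
  rewrite (_ : _ * _ = - (v 0 0 * a 0 0) * (v 0 0 * b 0 0)
      + v 0 0 ^+ 2 * (a 0 1 * b 0 1 + a 0 2 * b 0 2)).
    by rewrite eva evb vsq /alpha /beta; ring.
  by rewrite /mink; ring.
have v4 : v 0 0 ^+ 2 * v 0 0 ^+ 2 != 0 by rewrite mulf_neq0// expf_neq0.
apply: (mulfI v4).
transitivity ((v 0 0 ^+ 2 * mink a b) ^+ 2); first by ring.
by rewrite [RHS]mulrACA aa bb ab exprMn.
Qed.

Definition horiz x : 'rV[R]_2 := \row_j x 0 (lift 0 j).

Lemma horizE0 x : horiz x 0 0 = x 0 1.
Proof. by rewrite mxE; congr (x 0 _); exact: val_inj. Qed.

Lemma horizE1 x : horiz x 0 1 = x 0 2.
Proof. by rewrite mxE; congr (x 0 _); exact: val_inj. Qed.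

Fact horiz_is_linear : linear horiz.
Proof. by move=> c x y; apply/rowP => j; rewrite !mxE. Qed.

HB.instance Definition _ := GRing.isLinear.Build R 'rV[R]_3 'rV[R]_2 _ horiz
  horiz_is_linear.

Lemma norm_horiz_le x : `|horiz x| <= `|x|.
Proof. by apply: norm_rV_le => // j; rewrite mxE; exact: coord_le_norm. Qed.

Lemma mink_horiz k x : mink k x = - (k 0 0 * x 0 0) + dot (horiz k) (horiz x).
Proof. by rewrite /dot !horizE0 !horizE1 /mink addrA. Qed.

(** If [x] is orthogonal to [k], its time component is the scalar product of its
    horizontal part with the slope [horiz k / k0] of the plane [k^perp]. *)
Lemma mink_graph_slope k x : k 0 0 != 0 ->
  x 0 0 - dot ((k 0 0)^-1 *: horiz k) (horiz x) = - (k 0 0)^-1 * mink k x.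
Proof.
move=> k0; rewrite dotZl mink_horiz.
by rewrite [RHS]mulrDr mulrNN mulKf// mulNr.
Qed.

(** A degenerate plane contains no timelike vector, in particular no vertical
    one. *)
Lemma null_orthogonal_horiz_inj k w :
  null_vector k -> mink k w = 0 -> horiz w = 0 -> w = 0.
Proof.
move=> /null_vector_coord0 k0 kw hw.
move: kw; rewrite mink_horiz hw /dot !mxE !mulr0 !addr0 => /eqP.
rewrite oppr_eq0 mulf_eq0 (negbTE k0) => /eqP w0.
have w1 : w 0 1 = 0 by rewrite -horizE0 hw mxE.
have w2 : w 0 2 = 0 by rewrite -horizE1 hw mxE.
by apply: row3P; rewrite ?mxE.
Qed.

End Minkowski.

(** * The null normal of a lightlike surface *)

Section Chart.
Context {R : realType}.
Variables (S : set 'rV[R]_3) (U : set 'rV[R]_2) (X : 'rV[R]_2 -> 'rV[R]_3).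
Hypothesis X_param : local_param S U X.
Hypothesis S_lightlike : lightlike S.

Let oU : open U. Proof. by have [] := X_param. Qed.
Let X_smooth : smooth_on U X. Proof. by have [] := X_param. Qed.
Let X_diff z : U z -> differentiable X z.
Proof. by have [] := X_smooth 1; move=> + _; apply. Qed.
Let dX_inj z : U z -> injective ('d X z).
Proof. by have [_ _ _ _] := X_param; apply. Qed.

Lemma chart_image z : U z -> S (X z).
Proof.
move=> Uz; have [_ _ [Q _ XUQ] _ _] := X_param.
have : (X @` U) (X z) by exists z.
by rewrite XUQ => -[].
Qed.

Lemma chart_tangent z v : U z -> tangent S (X z) ('d X z v).
Proof.
move=> Uz; pose L : R -> 'rV[R]_2 := *:%R^~ v.
have LM : linear L by move=> c x y; rewrite /L scalerDl scalerA.
pose lL : {linear R -> 'rV[R]_2} := HB.pack L (GRing.isLinear.Build _ _ _ _ _ LM).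
have Lc : continuous lL by exact: scalel_continuous.
have oUL : open [set t | U (z + lL t)].
  apply: (@open_comp _ _ (fun t => z + lL t) U) => // t _.
  by apply: continuousD; [exact: cst_continuous|exact: Lc].
have /nbhs_ballP[e /= e0 eU] : nbhs (0 : R) [set t | U (z + lL t)].
  by apply: open_nbhs_nbhs; split => //=; rewrite /L scale0r addr0.
have eU' (t : R) : t \in `]- e, e[ -> U (z + lL t).
  move=> te; apply: eU; rewrite -ball_normE /= sub0r normrN ltr_norml.
  by move: te; rewrite in_itv.
exists (fun t => X (z + lL t)), e => //; split.
- move=> k; apply: (Ck_subset (U := [set t | U (z + lL t)])).
    by move=> t /=; exact: eU'.
  exact: Ck_comp_affine.
- by move=> t /eU' /chart_image.
- by rewrite /= /L scale0r addr0.
- have := @is_derive_line _ _ _ X z v 0; rewrite scale0r addr0; apply.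
  exact: X_diff.
Qed.

Definition normal z : 'rV[R]_3 :=
  lcross ('D_(delta_mx 0 0) X z) ('D_(delta_mx 0 1) X z).

Lemma diff_basis z w : U z ->
  'd X z w = w 0 0 *: 'D_(delta_mx 0 0) X z + w 0 1 *: 'D_(delta_mx 0 1) X z.
Proof.
move=> Uz; rewrite !deriveE; [|exact: X_diff|exact: X_diff].
rewrite -!linearZ -linearD; congr ('d X z _).
rewrite [LHS]row_sum_delta big_ord_recl big_ord1; congr (_ + _ *: _).
  by congr (w 0 _); exact: val_inj.
Qed.

Lemma normal_orthogonal z w : U z -> mink (normal z) ('d X z w) = 0.
Proof.
by move=> Uz; rewrite (diff_basis w Uz); exact: mink_lcross_span.
Qed.

Lemma normal_neq0 z : U z -> normal z != 0.
Proof.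
move=> Uz; apply/eqP => n0.
pose a := 'D_(delta_mx 0 0) X z; pose b := 'D_(delta_mx 0 1) X z.
have ab j : b 0 j *: a = a 0 j *: b by exact: lcross_eq0.
have da : 'd X z (delta_mx 0 0) = a by rewrite /a deriveE//; exact: X_diff.
have db : 'd X z (delta_mx 0 1) = b by rewrite /b deriveE//; exact: X_diff.
move: {n0} a b ab da db => a b ab da db.
have a0 : a = 0.
  apply/rowP => j; have : 'd X z (b 0 j *: delta_mx 0 0 - a 0 j *: delta_mx 0 1) = 0.
    by rewrite linearB !linearZ /= da db ab -scalerDr subrr scaler0.
  rewrite -[0 in RHS](linear0 ('d X z)) => /(dX_inj Uz)/rowP/(_ 1).
  rewrite !mxE /= mulr0 mulr1 add0r => /eqP.
  by rewrite oppr_eq0 => /eqP.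
have /(dX_inj Uz)/rowP/(_ 0) : 'd X z (delta_mx 0 0) = 'd X z 0.
  by rewrite linear0 da a0.
by rewrite !mxE /= => /eqP; rewrite oner_eq0.
Qed.

(** Here lightlikeness enters: the degenerate direction [v] is orthogonal to the
    whole tangent space, hence to itself. *)
Lemma normal_null z : U z -> null_vector (normal z).
Proof.
move=> Uz; split; first exact: normal_neq0.
have [v [tv v0 vT]] := S_lightlike (chart_image Uz).
rewrite mink_lcross (@null_orthogonal_gram _ v) ?subrr//.
- by split => //; exact: vT.
- rewrite deriveE; last exact: X_diff.
  by apply: vT; exact: chart_tangent.
- rewrite deriveE; last exact: X_diff.
  by apply: vT; exact: chart_tangent.
Qed.

Lemma horiz_diff_inj z w : U z -> horiz ('d X z w) = 0 -> w = 0.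
Proof.
move=> Uz hw; apply: (dX_inj Uz); rewrite linear0.
apply: (@null_orthogonal_horiz_inj _ (normal z)) hw; first exact: normal_null.
exact: normal_orthogonal.
Qed.

Lemma Ck_horiz k (V : normedModType R) (D : set V) (g : V -> 'rV[R]_3) :
  open D -> Ck k D g -> Ck k D (horiz \o g).
Proof. exact/Ck_linear/linear_rV_continuous. Qed.

Lemma diff_horiz (V : normedModType R) (g : V -> 'rV[R]_3) z v :
  differentiable g z -> 'd (horiz \o g) z v = horiz ('d g z v).
Proof.
move=> gz; have hc : continuous (@horiz R) by exact: linear_rV_continuous.
rewrite diff_comp//; first by rewrite /= diff_lin.
exact: linear_differentiable.
Qed.

Lemma Ck_normal k : Ck k U normal.
Proof.
have CX i j : Ck k U (fun z => 'D_(delta_mx 0 i) X z 0 j).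
  by apply: Ck_coord => //; have [_] := X_smooth k.+1; apply.
have CXX i j i' j' : Ck k U ((fun z => 'D_(delta_mx 0 i) X z 0 j) *
   (fun z => 'D_(delta_mx 0 i') X z 0 j')) by apply: CkM.
apply: Ck_rV => // j.
case: (ord3P j) => ->; under eq_fun do rewrite row3E.
- exact: (CkB oU (CXX 0 2 1 1) (CXX 0 1 1 2)).
- exact: (CkB oU (CXX 0 2 1 0) (CXX 0 0 1 2)).
- exact: (CkB oU (CXX 0 0 1 1) (CXX 0 1 1 0)).
Qed.

(** * Null lines contained in the surface *)

(** [X] is a homeomorphism onto its image, which is open in [S]. *)
Lemma chart_open O : open O -> O `<=` U -> open_in S (X @` O).
Proof.
move=> oO OU; have [_ _ [Q oQ XUQ] [Y YX Yc] _] := X_param.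
have oYO : open (Y @^-1` O : set (subspace (X @` U))).
  by apply: open_comp => // x _; exact: Yc.
have /open_subspaceP[A oA AY] := oYO.
exists (Q `&` A); first exact: openI.
rewrite setIA -XUQ setIC; apply/seteqP; split => [_ [z Oz <-]|q].
  have XUz : (X @` U) (X z) by exists z => //; exact: OU.
  have : (Y @^-1` O `&` X @` U) (X z) by split => //=; rewrite YX//; exact: OU.
  by rewrite -AY.
rewrite AY => -[/= YO [z Uz zq]]; exists z => //.
by move: YO; rewrite -zq YX.
Qed.

(** The graph function [u] and its gradient [p] are defined through the inverse
    [g] of [f], which need not be differentiated: the lower Lipschitz bound for
    [f] turns an error [o(|w - z|)] in the chart into [o(|f w - f z|)] in the
    plane.  The time [t K0] in [eikonal_line] appears because [p] is [K] scaled
    to have time component 1. *)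
Lemma null_lines z0 : U z0 ->
  exists r : R, [/\ 0 < r, ball z0 r `<=` U,
    forall z w, ball z0 r z -> ball z0 r w -> horiz (X z) = horiz (X w) -> z = w,
    open ((horiz \o X) @` ball z0 r)
  & forall z rho t, ball z0 r z ->
      disc (horiz (X z)) rho `<=` (horiz \o X) @` ball z0 r ->
      `|t * normal z 0 0| <= rho ->
      exists2 w, ball z0 r w & X w = X z + t *: normal z].
Proof.
move=> Uz0; pose f := horiz \o X.
have fC : Ck 1 U f by apply: Ck_horiz => //; exact: X_smooth.
have fd z : U z -> differentiable f z by have [+ _] := fC; apply.
have dfE z v : U z -> 'd f z v = horiz ('d X z v).
  by move=> Uz; rewrite diff_horiz//; exact: X_diff.
have df_inj : injective ('d f z0).
  move=> a b ab; apply/eqP; rewrite -subr_eq0; apply/eqP.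
  apply: (horiz_diff_inj Uz0).
  by rewrite -dfE// linearB ab subrr.
have [r [c [r0 c0 rU fc fO]]] := local_homeo oU Uz0 fC df_inj.
have finj z w : ball z0 r z -> ball z0 r w -> f z = f w -> z = w.
  exact: (lower_lipschitz_inj c0).
exists r; split => //.
- by apply: fO => //; exact: ball_open.
have [|g gf _] := lower_lipschitz_inverse c0 fc.
  by exists z0; exact: ballxx.
pose u y := X (g y) 0 0.
pose K := normal.
pose p y := (K (g y) 0 0)^-1 *: horiz (K (g y)).
have uP z : ball z0 r z -> [/\ differentiable u (f z),
    forall v, 'd u (f z) v = dot (p (f z)) v & enorm (p (f z)) = 1].
  move=> rz; have Uz := rU _ rz.
  have Kn := normal_null Uz.
  have K0 := null_vector_coord0 Kn; have [_ KK] := Kn.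
  have nK0 : 0 < `|K z 0 0| by rewrite normr_gt0.
  have pK : p (f z) = (K z 0 0)^-1 *: horiz (K z) by rewrite /p gf.
  have lin_dot : linear (dot (p (f z)) : _ -> R).
    by move=> a x y; rewrite dotDr dotZr.
  pose L : {linear 'rV[R]_2 -> R} := HB.pack (dot (p (f z)) : _ -> R)
    (GRing.isLinear.Build _ _ _ _ _ lin_dot).
  have lin_mink : linear (mink (K z) : _ -> R).
    by move=> a x y; rewrite minkDr minkZr.
  pose M : {linear 'rV[R]_3 -> R} := HB.pack (mink (K z) : _ -> R)
    (GRing.isLinear.Build _ _ _ _ _ lin_mink).
  have [C C0 MC] := linear_lipschitz (@linear_rV_continuous _ _ _ M).
  have [] := @approx_differentiable _ _ _ u (f z) L.
  - exact: linear_rV_continuous.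
  - move=> e e0; pose e' := e * c * `|K z 0 0| / C.
    have e'0 : 0 < e' by exact: (divr_gt0 (mulr_gt0 (mulr_gt0 e0 c0) nK0) C0).
    have /nbhs_ballP[d /= d0 dX] := differentiable_approx (X_diff Uz) e'0.
    have oB : open (ball z d `&` ball z0 r) by apply: openI; exact: ball_open.
    have : nbhs (f z) (f @` (ball z d `&` ball z0 r)).
      apply: open_nbhs_nbhs; split; first by apply: fO => // w [].
      exact: (ex_intro2 _ _ z (conj (ballxx _ d0) rz) erefl).
    apply: filterS => _ [w [dw rw] <-].
    have -> : u (f w) - u (f z) - L (f w - f z) =
        - (K z 0 0)^-1 * mink (K z) (X w - X z - 'd X z (w - z)).
      rewrite minkDr minkNr (normal_orthogonal (w - z) Uz) subr0.
      rewrite -(mink_graph_slope _ K0).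
      rewrite -[L _]/(dot (p (f z)) (f w - f z)) pK linearB /u (gf _ rw) (gf _ rz).
      by congr (_ - _); rewrite mxE mxE.
    rewrite normrM normrN normfV.
    exact: (rescaled_error c0 nK0 C0 e0 (MC _) (dX _ dw) (fc _ _ rw rz)).
  - move=> ud uL; split; [exact: ud|by move=> v; rewrite uL|].
    have dd : dot (horiz (K z)) (horiz (K z)) = K z 0 0 ^+ 2.
      move: KK; rewrite -/K mink_horiz => /eqP; rewrite addrC subr_eq0 => /eqP ->.
      by rewrite expr2.
    rewrite pK enormZ /enorm dd sqrtr_sqr normfV.
    exact/mulVf/lt0r_neq0.
move=> z rho t rz Drho trho.
have fz : horiz (X z) = f z by [].
have Uz := rU _ rz.
have K0 := null_vector_coord0 (normal_null Uz).
have line := @eikonal_line R u p (f z) rho (t * K z 0 0).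
have tp : (t * K z 0 0) *: p (f z) = t *: horiz (K z).
  by rewrite /p gf// scalerA mulfK.
have [w rw fw] : (f @` ball z0 r) (f z + t *: horiz (K z)).
  apply: Drho; rewrite /disc /= -fz addrAC subrr add0r -tp enormZ.
  by have [_ _ ->] := uP z rz; rewrite mulr1.
exists w => //.
have : u (f z + (t * K z 0 0) *: p (f z)) = u (f z) + t * K z 0 0.
  by apply: line => // y /Drho[w' rw' <-]; exact: uP.
rewrite tp -fw /u !gf// => Xw0.
have hXw : horiz (X w) = horiz (X z + t *: K z) by rewrite linearD linearZ.
apply: row3P.
- by rewrite Xw0 !mxE.
- by rewrite -!horizE0 hXw.
- by rewrite -!horizE1 hXw.
Qed.

(** * The ruled parametrization *)

Section AtPoint.
Variable z0 : 'rV[R]_2.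
Hypothesis Uz0 : U z0.

(** The two partial derivatives of [X] are independent, so they are not both
    multiples of the normal. *)
Lemma transversal_direction : exists b : 'rV[R]_2,
  forall s t : R, s *: 'd X z0 b + t *: normal z0 = 0 -> s = 0 /\ t = 0.
Proof.
have Kn0 : normal z0 != 0 by exact: (normal_neq0 Uz0).
move: (normal z0) Kn0 => K Kn0.
have injd := dX_inj Uz0.
have indep b : ~ (exists l, 'd X z0 b = l *: K) ->
    forall s t : R, s *: 'd X z0 b + t *: K = 0 -> s = 0 /\ t = 0.
  move=> bK s t st; have s0 : s = 0.
    apply/eqP/negPn/negP => s0; apply: bK; exists (- (t / s)).
    apply: (scalerI s0); rewrite scalerA mulrN mulrC mulfVK// scaleNr.
    by apply/eqP; rewrite -addr_eq0; apply/eqP.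
  split=> //; move: st; rewrite s0 scale0r add0r => /eqP.
  by rewrite scaler_eq0 (negbTE Kn0) orbF => /eqP.
pose e0 : 'rV[R]_2 := row2 1 0; pose e1 : 'rV[R]_2 := row2 0 1.
have [[l el]|/indep H] := pselect (exists l, 'd X z0 e0 = l *: K);
  last by exists e0.
have [[m em]|/indep H] := pselect (exists m, 'd X z0 e1 = m *: K);
  last by exists e1.
exfalso.
have H : m *: e0 - l *: e1 = 0.
  apply: injd; rewrite linear0 linearB !linearZ /= el em ?scalerN !scalerA.
  by rewrite (mulrC m) subrr.
have l0 : l = 0.
  have := congr1 (fun v : 'rV[R]_2 => v 0 1) H.
  by rewrite !mxE /= mulr0 mulr1 add0r => /eqP; rewrite oppr_eq0 => /eqP.
have : e0 = 0 by apply: injd; rewrite linear0 el l0 scale0r.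
move/(congr1 (fun v : 'rV[R]_2 => v 0 0)); rewrite !mxE /= => /eqP.
by rewrite oner_eq0.
Qed.

Section Ruling.
Variable b : 'rV[R]_2.
Hypothesis bK : forall s t : R,
  s *: 'd X z0 b + t *: normal z0 = 0 -> s = 0 /\ t = 0.

Definition ruling (z : 'rV[R]_2) : 'rV[R]_3 :=
  X (z0 + along b z) + z 0 1 *: normal (z0 + along b z).

Let D := [set z | U (z0 + along b z)].

Let oD : open D.
Proof.
apply: (@open_comp _ _ (fun z => z0 + along b z) U) => // z _.
by apply: continuousD; [exact: cst_continuous|exact: linear_rV_continuous].
Qed.

Let D0 : D 0. Proof. by rewrite /D /= linear0 addr0. Qed.

Lemma ruling_smooth : smooth_on D ruling.
Proof.
move=> k; have bc : continuous (along b) by exact: linear_rV_continuous.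
have CX := Ck_comp_affine z0 bc oU (X_smooth k).
have CN := Ck_comp_affine z0 bc oU (Ck_normal k).
apply: (CkD oD CX); apply: (Ck_rV oD) => j.
have H := CkM oD (Ck_coord 1 oD (Ck_id k D)) (Ck_coord j oD CN).
apply: (Ck_eq_on oD) H => z _.
by rewrite [RHS]mxE.
Qed.

Lemma diff_ruling0 v :
  'd ruling 0 v = v 0 0 *: 'd X z0 b + v 0 1 *: normal z0.
Proof.
have bc : continuous (along b) by exact: linear_rV_continuous.
have Ad : differentiable (fun z => X (z0 + along b z)) 0.
  by have [+ _] := Ck_comp_affine z0 bc oU (X_smooth 1); apply; exact: D0.
have Nd : differentiable (fun z => normal (z0 + along b z)) 0.
  by have [+ _] := Ck_comp_affine z0 bc oU (Ck_normal 1); apply; exact: D0.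
have l_lin : linear (fun z : 'rV[R]_2 => z 0 1) by move=> k x y; rewrite !mxE.
pose l : {linear 'rV[R]_2 -> R} := HB.pack (fun z : 'rV[R]_2 => z 0 1)
  (GRing.isLinear.Build _ _ _ _ _ l_lin).
have lc : continuous l by exact: linear_rV_continuous.
have zb : z0 + along b 0 = z0 by rewrite linear0 addr0.
have Xd : differentiable X (z0 + along b 0) by rewrite zb; exact: X_diff.
have E := diff_add_scale v lc Ad Nd.
have E' := diff_comp_affine v bc Xd.
have E2 : 'd (fun z => X (z0 + along b z)) 0 v = v 0 0 *: 'd X z0 b.
  apply: (etrans E').
  by rewrite zb /along linearZ.
apply: (etrans E).
exact: (congr2 +%R E2 (congr1 (fun z => v 0 1 *: normal z) zb)).
Qed.

(** At 0 the differential of the ruling takes values in the tangent plane at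
    [X z0], on which the horizontal projection is injective. *)
Lemma diff_horiz_ruling0_inj : injective ('d (horiz \o ruling) 0).
Proof.
have [+ _] := ruling_smooth 1; move=> /(_ 0 D0) rd.
move=> x y xy; apply/eqP; rewrite -subr_eq0; apply/eqP.
have := diff_horiz (x - y) rd; rewrite linearB xy subrr => /esym hw.
have Kn := normal_null Uz0.
have : 'd ruling 0 (x - y) = 0.
  apply: (null_orthogonal_horiz_inj Kn _ hw).
  rewrite diff_ruling0 minkDr !minkZr (normal_orthogonal b Uz0).
  by have [_ ->] := Kn; rewrite !mulr0 addr0.
rewrite diff_ruling0 => /bK[xy0 xy1].
by apply: row2P; rewrite ?xy0 ?xy1 mxE.
Qed.

End Ruling.

(** The ruling maps a small square onto the image under [X] of an open set [V],
    because both lie in the image of the ball given by [null_lines], where the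
    horizontal projection separates points. *)
Lemma ruling_param : exists (b : 'rV[R]_2) (d : R), [/\ 0 < d,
  local_param S (rectangle (- d) d (- d) d) (ruling b) &
  forall z, rectangle (- d) d (- d) d z -> U (z0 + along b z)].
Proof.
have [b bK] := transversal_direction.
pose Phi := ruling b; pose gam z := z0 + along b z.
pose D : set 'rV[R]_2 := [set z | U (gam z)].
pose f := horiz \o X.
have gamc : continuous gam.
  by move=> z; apply: continuousD; [exact: cst_continuous|exact: linear_rV_continuous].
have gam0 : gam 0 = z0 by rewrite /gam linear0 addr0.
have oD : open D by apply: (@open_comp _ _ gam U) => // z _; exact: gamc.
have D0 : D 0 by rewrite /D /= gam0.
have Phi_smooth : smooth_on D Phi := ruling_smooth b.
have [r [r0 rU f_inj f_open lines]] := null_lines Uz0.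
have F_inj := diff_horiz_ruling0_inj bK.
have F_C1 : Ck 1 D (horiz \o Phi) by exact: (Ck_horiz oD (Phi_smooth 1%N)).
have [r' [c [r'0 c0 r'D Fc FO]]] := local_homeo oD D0 F_C1 F_inj.
have [rho /= rho0 rho_sub] : nbhs_ball (f z0) (f @` ball z0 r).
  apply/nbhs_ballP/open_nbhs_nbhs; split; first exact: f_open.
  by exists z0 => //; exact: ballxx.
have rho4 : 0 < rho / 4 by rewrite divr_gt0.
have fc z : U z -> {for z, continuous f}.
  move=> Uz; apply: continuous_comp; first exact/differentiable_continuous/X_diff.
  exact: linear_rV_continuous.
have near0 : \forall z \near (0 : 'rV[R]_2), [/\ ball z0 r (gam z),
    ball (f z0) (rho / 4) (f (gam z))
  & `|z 0 1 * normal (gam z) 0 0| <= rho / 4].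
  have c1 : {for 0, continuous (f \o gam)}.
    by apply: continuous_comp; [exact: gamc|rewrite gam0; exact: fc].
  have c2 : {for (0 : 'rV[R]_2),
      continuous (fun z : 'rV[R]_2 => z 0 1 * normal (gam z) 0 0)}.
    apply: (@continuousM _ _ (fun z : 'rV[R]_2 => z 0 1)
      (fun z => normal (gam z) 0 0)); first exact: coord_continuous.
    apply: (@continuous_comp _ _ _ gam (fun w => normal w 0 0)); first exact: gamc.
    rewrite gam0; have := Ck_coord 0 oU (Ck_normal 0); exact.
  have n1 : \forall z \near (0 : 'rV[R]_2), ball z0 r (gam z).
    by apply: (gamc 0); rewrite gam0; exact: nbhsx_ballx.
  have n2 : \forall z \near (0 : 'rV[R]_2), ball (f z0) (rho / 4) (f (gam z)).
    by apply: c1; rewrite /= gam0; exact: nbhsx_ballx.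
  have n3 : \forall z \near (0 : 'rV[R]_2),
      `|(z : 'rV[R]_2) 0 1 * normal (gam z) 0 0| <= rho / 4.
    move/cvgrPdist_le : c2 => /(_ _ rho4) H.
    by apply: filterS H => z; rewrite mxE mul0r sub0r normrN.
  by near=> z; split; near: z.
have /nbhs_ballP[d1 /= d10 d1P] := near0.
pose d := Num.min d1 r'.
have d0 : 0 < d by rewrite lt_min d10.
have dd1 : ball (0 : 'rV[R]_2) d `<=` ball 0 d1.
  by apply: le_ball; rewrite ge_min lexx.
have dr' : ball (0 : 'rV[R]_2) d `<=` ball 0 r'.
  by apply: le_ball; rewrite ge_min lexx orbT.
have on_S z : ball 0 d z -> exists2 w, ball z0 r w & X w = Phi z.
  move=> /dd1/d1P[rz fz tz]; apply: (lines _ (rho / 4)) => //.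
  move=> y yD; apply: rho_sub; rewrite -ball_normE /=.
  move: fz; rewrite -ball_normE /= => fz.
  rewrite -(subrKA (f (gam z))) (le_lt_trans (ler_normD _ _))//.
  have : `|f (gam z) - y| <= rho / 4.
    rewrite distrC; apply: le_trans (norm_le_enorm _) _; exact: yD.
  lra.
pose V := [set w | ball z0 r w /\ ((horiz \o Phi) @` ball 0 d) (f w)].
have VU : V `<=` U by move=> w [/rU].
have oV : open V.
  rewrite openE => w Vw; have [rw Fw] := Vw.
  apply: filterI; first by apply: open_nbhs_nbhs; split => //; exact: ball_open.
  apply: (fc _ (rU _ rw)); apply: open_nbhs_nbhs; split => //.
  by apply: FO => //; exact: ball_open.
have PhiV : Phi @` ball 0 d = X @` V.
  apply/seteqP; split => [_ [z dz <-]|_ [w [rw [z dz zw]] <-]].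
    have [w rw Xw] := on_S _ dz; exists w => //; split => //.
    by exists z => //; rewrite /= -Xw.
  exists z => //; have [w' rw' Xw'] := on_S _ dz.
  by rewrite -Xw' (f_inj w' w)// Xw'.
have Phi_low z z' : ball 0 d z -> ball 0 d z' -> c * `|z - z'| <= `|Phi z - Phi z'|.
  move=> /dr' dz /dr' dz'; apply: le_trans (Fc _ _ dz dz') _.
  by rewrite /= -linearB; exact: norm_horiz_le.
have dD : ball 0 d `<=` D by move=> z /dr'/r'D.
exists b, d; rewrite rectangle_ball//; split => //; split.
- exact: ball_open.
- by move=> k; exact: Ck_subset dD (Phi_smooth k).
- by rewrite PhiV; exact: chart_open oV VU.
- apply: (lower_lipschitz_inverse c0 Phi_low).
  by exists 0; exact: ballxx.
- move=> z dz; have oB : open (ball (0 : 'rV[R]_2) d) by exact: ball_open.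
  apply: (lower_lipschitz_diff_inj c0 Phi_low oB dz).
  by have [+ _] := Phi_smooth 1%N; apply; exact: dD.
Unshelve. all: by end_near. Qed.

End AtPoint.
End Chart.

(** * The foliation by null segments *)

Section Foliation.
Context {R : realType}.
Variables (S : set 'rV[R]_3) (Phi : 'rV[R]_2 -> 'rV[R]_3) (a b c d : R).
Let rect := rectangle a b c d.
Hypothesis Phi_param : local_param S rect Phi.
Hypothesis cd : c < d.
Variables x v : R -> 'rV[R]_3.
Hypothesis v_null : forall s, a < s < b -> null_vector (v s).
Hypothesis PhiE : forall z, rect z -> Phi z = x (z 0 0) + z 0 1 *: v (z 0 0).

(** Injectivity of [Phi] makes the leaves disjoint and lets each of them meet
    the chart in a single slice, so [Phi] itself is the flat chart at every
    point. *)
Lemma foliated_chart : exists F, foliated_by_null_segments S (Phi @` rect) F.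
Proof.
have [_ _ _ [Y YPhi _] _] := Phi_param.
have Phi_inj z w : rect z -> rect w -> Phi z = Phi w -> z = w.
  by move=> rz rw e; rewrite -(YPhi _ rz) -(YPhi _ rw) e.
pose slice s := Phi @` [set z | rect z /\ z 0 0 = s].
exists [set slice s | s in [set s | a < s < b]]; split.
- move=> _ [s sab <-]; exists (x s), (v s), c, d; split => //; first exact: v_null.
  apply/seteqP; split => [_ [z [rz zs] <-]|_ [t tcd <-]].
    have [_ z1] := rz.
    by exists (z 0 1); [rewrite /= in_itv|rewrite PhiE// zs].
  have rz : rect (row2 s t).
    by split; rewrite ?row2E0 ?row2E1 //; move: tcd; rewrite /= in_itv.
  by exists (row2 s t); [split; rewrite ?row2E0|rewrite PhiE// row2E0 row2E1].
- move=> _ _ [s sab <-] [s' s'ab <-] [q [[z [rz zs] zq] [w [rw ws] wq]]].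
  by rewrite -zs -ws (Phi_inj z w)// zq wq.
- apply/seteqP; split => [q [_ [s _ <-] [z [rz _] <-]]|_ [z rz <-]]; first by exists z.
  have [z0 _] := rz.
  by exists (slice (z 0 0)); [exists (z 0 0)|exists z].
- move=> p Wp; exists a, b, c, d, Phi; split => //; split => //.
  move=> _ [s sab <-]; exists [set s]; first exact: countable1.
  move=> z rz; split => [[w [rw ws] /(Phi_inj _ _ rw rz) <-]|zs]; first exact: ws.
  by exists z.
Qed.

End Foliation.

Theorem corollary4p3 (R : realType) (S : set 'rV[R]_3)
    (S_regular : regular_surface S) (S_lightlike : lightlike S)
    (S_constant_type : constant_type S) :
  ruled_by_null_lines S.
Proof.
move=> p /S_regular[U [X [X_param [z0 Uz0 z0p]]]].
have [b [d [d0 Phi_param dU]]] := ruling_param X_param S_lightlike Uz0.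
set rect := rectangle _ _ _ _ in Phi_param dU.
have dd : - d < d by rewrite (lt_trans _ d0)// oppr_lt0.
have [|z _|F FP] := @foliated_chart R S _ _ _ _ _ Phi_param dd
    (fun s => X (z0 + s *: b)) (fun s => normal X (z0 + s *: b)).
- move=> s sd; apply: (normal_null X_param S_lightlike).
  have := dU (row2 s 0); rewrite /along row2E0; apply.
  by split; rewrite ?row2E0 ?row2E1// oppr_lt0 d0.
- by [].
exists (ruling X z0 b @` rect), F; split => //; first by have [] := Phi_param.
exists 0; first by rewrite /rect rectangle_ball//; exact: ballxx.
by rewrite /ruling linear0 addr0 mxE scale0r addr0.
Qed.
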